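(* Let $k$ be a field of characteristic $p>0$, let $q>1$ be a power of $p$, let $H$ be a finite $p$-group such that $kH$ has non-finite representation type, and let $G=H\times C_q$, where $C_q$ is a cyclic group of order $q$. Set $w=\mathrm{Ind}_H^G(k)$. Then $\mathrm{StMod}_w(kG)$ is not generated by $\mathrm{stmod}_w(kG)$.
   Context: $\mathrm{Mod}(kG)$ is the category of all $kG$-modules and $\mathrm{mod}(kG)$ is the full subcategory of finite dimensional ones. Tensor products of modules are over $k$ with the diagonal group action. For a finite dimensional $kG$-module $w$, $\mathcal{P}(w)$ denotes the smallest additive (full) subcategory of $\mathrm{Mod}(kG)$ that contains $w$ and is closed under tensoring with an arbitrary $kG$-module and under arbitrary direct sums and direct summands. Objects of $\mathcal{P}(w)$ are called $w$-projective. The class of short exact sequences in $\mathrm{Mod}(kG)$ that split when tensored with $w$ is an exact structure whose projective objects and injective objects are both exactly $\mathcal{P}(w)$, with enough of both. The resulting triangulated quotients are $\mathrm{StMod}_w(kG):=\mathrm{Mod}(kG)/\mathcal{P}(w)$ and $\mathrm{stmod}_w(kG):=\mathrm{mod}(kG)/(\mathcal{P}(w)\cap \mathrm{mod}(kG))$: the objects are the same as those of the original category, and morphisms are module homomorphisms modulo those factoring through a $w$-projective module. $\mathrm{stmod}_w(kG)$ is regarded as a full subcategory of $\mathrm{StMod}_w(kG)$. If $\mathcal{S}\subset\mathcal{T}$ are triangulated categories, $\mathcal{S}$ generates $\mathcal{T}$ if, for every object $X$ of $\mathcal{T}$, $\mathrm{Hom}_{\mathcal{T}}(S,X)=0$ for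 all $S\in\mathcal{S}$ implies $X\cong 0$. $kH$ has non-finite representation type if it has infinitely many isomorphism classes of finite dimensional indecomposable modules. *)

(* Defs.v *)
From HB Require Import structures.
From mathcomp Require Import all_boot all_order all_algebra all_fingroup all_solvable.
Set Implicit Arguments.
Unset Strict Implicit.
Unset Printing Implicit Defensive.
Import GroupScope GRing.Theory.
Local Open Scope ring_scope.

(* A left kG-module, of arbitrary dimension, is given as a k-vector space with
   a k-linear action of G. *)
Record kGmod (k : fieldType) (G : finGroupType) := KGmod {
  kGcar :> lmodType k;
  kGact : G -> {linear kGcar -> kGcar};
  kGact1 : forall v, kGact 1%g v = v;
  kGactM : forall g h v, kGact (g * h)%g v = kGact g (kGact h v)
}.

Record kGhom (k : fieldType) (G : finGroupType) (M N : kGmod k G) := KGhom {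
  kGfun :> {linear M -> N};
  kGhomP : forall g v, kGfun (kGact M g v) = kGact N g (kGfun v)
}.

Section Modules.
Variables (k : fieldType) (G : finGroupType).
Implicit Types M N : kGmod k G.

Definition kGid M : kGhom M M :=
  @KGhom k G M M idfun (fun _ _ => erefl).

Lemma kGcompP M N L (f : kGhom N L) (h : kGhom M N) g v :
  (f \o h) (kGact M g v) = kGact L g ((f \o h) v).
Proof. by rewrite /= !kGhomP. Qed.

Definition kGcomp M N L (f : kGhom N L) (h : kGhom M N) : kGhom M L :=
  @KGhom k G M L (f \o h) (kGcompP f h).

Lemma kGzeroP M N g (v : M) :
  (\0 : M -> N) (kGact M g v) = kGact N g ((\0 : M -> N) v).
Proof. by rewrite /= linear0. Qed.

Definition kGzero M N : kGhom M N := @KGhom k G M N \0 (@kGzeroP M N).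

Definition kGiso M N : Prop :=
  exists (f : kGhom M N) (h : kGhom N M), cancel f h /\ cancel h f.

Definition kGtriv_mod (V : lmodType k) : kGmod k G :=
  @KGmod k G V (fun=> idfun) (fun _ => erefl) (fun _ _ _ => erefl).

Definition kGunit : kGmod k G := kGtriv_mod k^o.

Definition kG0 : kGmod k G := kGtriv_mod 'rV[k]_0.

Definition kGsum_act M N g (v : M * N) : M * N := (kGact M g v.1, kGact N g v.2).

Lemma kGsum_act_linear M N g : linear (@kGsum_act M N g).
Proof. by move=> a u v; rewrite /kGsum_act /= !linearP. Qed.

HB.instance Definition _ M N g :=
  GRing.isLinear.Build k (M * N)%type (M * N)%type *:%R (@kGsum_act M N g)
    (@kGsum_act_linear M N g).

Lemma kGsum_act1 M N (v : M * N) : kGsum_act 1%g v = v.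
Proof. by case: v => u v; rewrite /kGsum_act /= !kGact1. Qed.

Lemma kGsum_actM M N g h (v : M * N) :
  kGsum_act (g * h)%g v = kGsum_act g (kGsum_act h v).
Proof. by rewrite /kGsum_act /= !kGactM. Qed.

Definition kGsum M N : kGmod k G :=
  @KGmod k G (M * N)%type (fun g => @kGsum_act M N g : {linear _ -> _})
    (@kGsum_act1 M N) (@kGsum_actM M N).

Definition kGsummand M N : Prop := exists M', kGiso N (kGsum M M').

Definition is_direct_sum (I : Type) (M : I -> kGmod k G) (S : kGmod k G)
    (i_ : forall i, kGhom (M i) S) : Prop :=
  forall N (f : forall i, kGhom (M i) N),
    exists h : kGhom S N,
      (forall i v, h (i_ i v) = f i v) /\
      (forall h' : kGhom S N, (forall i v, h' (i_ i v) = f i v) -> h' =1 h).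

Definition bilinear_map (U V W : lmodType k) (b : U -> V -> W) : Prop :=
  (forall u, linear (b u)) /\ (forall v, linear (b^~ v)).

(* T is the tensor product over k of M and N, with diagonal action of G. *)
Definition is_tensor M N (T : kGmod k G) (t : M -> N -> T) : Prop :=
  [/\ bilinear_map t,
      forall g u v, t (kGact M g u) (kGact N g v) = kGact T g (t u v)
    & forall (U : lmodType k) (b : M -> N -> U), bilinear_map b ->
        exists h : {linear T -> U},
          (forall u v, h (t u v) = b u v) /\
          (forall h' : {linear T -> U},
             (forall u v, h' (t u v) = b u v) -> h' =1 h)].

Definition kGfindim M : Prop :=
  exists (n : nat) (e : 'I_n -> M),
    forall v, exists c : 'I_n -> k, v = \sum_i c i *: e i.

Definition kGindecomposable M : Prop :=
  ~ kGiso M kG0 /\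
  forall A B, kGiso M (kGsum A B) -> kGiso A kG0 \/ kGiso B kG0.

(* The class of w-projective modules; it contains 0 (the empty direct sum) and
   is closed under isomorphism (a case of direct summands). *)
Inductive wprojective (w : kGmod k G) : kGmod k G -> Prop :=
| wproj_self : wprojective w w
| wproj_tensor (M N T : kGmod k G) (t : M -> N -> T) :
    wprojective w M -> is_tensor t -> wprojective w T
| wproj_sum (I : Type) (M : I -> kGmod k G) (S : kGmod k G)
    (i_ : forall i, kGhom (M i) S) :
    (forall i, wprojective w (M i)) -> is_direct_sum i_ -> wprojective w S
| wproj_summand (M N : kGmod k G) :
    wprojective w N -> kGsummand M N -> wprojective w M.

(* f and h are the same morphism of StMod_w(kG). *)
Definition stable_eq (w M N : kGmod k G) (f h : kGhom M N) : Prop :=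
  exists (P : kGmod k G) (a : kGhom M P) (b : kGhom P N),
    wprojective w P /\ forall v, f v - h v = b (a v).

Definition stable_iso (w M N : kGmod k G) : Prop :=
  exists (f : kGhom M N) (h : kGhom N M),
    stable_eq w (kGcomp h f) (kGid M) /\ stable_eq w (kGcomp f h) (kGid N).

(* The full subcategory of StMod_w(kG) on the class S generates StMod_w(kG). *)
Definition generates_StMod (w : kGmod k G) (S : kGmod k G -> Prop) : Prop :=
  forall X : kGmod k G,
    (forall (M : kGmod k G), S M ->
       forall f : kGhom M X, stable_eq w f (kGzero M X)) ->
    stable_iso w X kG0.

Definition finite_rep_type : Prop :=
  exists (n : nat) (D : 'I_n -> kGmod k G),
    forall M, kGfindim M -> kGindecomposable M -> exists i, kGiso M (D i).

End Modules.
Arguments kG0 {k G}.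

Section Induction.
Variables (k : fieldType) (H G : finGroupType).
Variables (iota : {morphism [set: H] >-> G}) (M : kGmod k H).

(* Ind_H^G(M) = kG (x)_kH M for an embedding iota of H in G, as the space of
   functions f : G -> M with f (g h) = h^-1 (f g); the tensor g (x) m is the
   function supported on the coset gH whose value at g is m (see
   ind_universal). *)
Definition ind_pred : {pred {ffun G -> M}} :=
  [pred f : {ffun G -> M} |
     [forall g, forall h, f (g * iota h)%g == kGact M h^-1%g (f g)]].

Lemma ind_predP (f : {ffun G -> M}) :
  reflect (forall g h, f (g * iota h)%g = kGact M h^-1%g (f g)) (f \in ind_pred).
Proof.
apply: (iffP forallP) => [F g h | F g]; first by have /forallP/(_ h)/eqP := F g.
by apply/forallP => h; apply/eqP.
Qed.

Lemma ind_submod_closed : submod_closed ind_pred.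
Proof.
split=> [|a f f' /ind_predP Ff /ind_predP Ff']; apply/ind_predP => g h.
  by rewrite !ffunE linear0.
by rewrite !ffunE Ff Ff' linearP.
Qed.

HB.instance Definition _ :=
  GRing.isSubmodClosed.Build k {ffun G -> M} ind_pred ind_submod_closed.

Record ind_car := IndCar {ind_fun :> {ffun G -> M}; _ : ind_fun \in ind_pred}.
HB.instance Definition _ := [isSub for ind_fun].
HB.instance Definition _ := [Choice of ind_car by <:].
HB.instance Definition _ := [SubChoice_isSubLmodule of ind_car by <:].

Lemma ind_carP (f : ind_car) g h : f (g * iota h)%g = kGact M h^-1%g (f g).
Proof. by apply/ind_predP: g h; case: f. Qed.

Lemma ind_act_subproof g (f : ind_car) : [ffun x => f (g^-1 * x)%g] \in ind_pred.
Proof. by apply/ind_predP => x h; rewrite !ffunE mulgA ind_carP. Qed.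

Definition ind_act g (f : ind_car) : ind_car := IndCar (ind_act_subproof g f).

Lemma ind_actE g f x : ind_act g f x = f (g^-1 * x)%g.
Proof. by rewrite ffunE. Qed.

Lemma ind_funP (f f' : ind_car) : (forall g, f g = f' g) -> f = f'.
Proof. by move=> E; apply/val_inj/ffunP. Qed.

Lemma ind_act_linear g : linear (ind_act g).
Proof. by move=> a u v; apply: ind_funP => x; rewrite !ffunE. Qed.

HB.instance Definition _ g :=
  GRing.isLinear.Build k ind_car ind_car *:%R (ind_act g) (ind_act_linear g).

Lemma ind_act1 f : ind_act 1%g f = f.
Proof. by apply: ind_funP => x; rewrite ind_actE invg1 mul1g. Qed.

Lemma ind_actM g h f : ind_act (g * h)%g f = ind_act g (ind_act h f).
Proof. by apply: ind_funP => x; rewrite !ind_actE invMg mulgA. Qed.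

Definition kGind : kGmod k G :=
  @KGmod k G ind_car (fun g => ind_act g : {linear _ -> _}) ind_act1 ind_actM.

Section Universal.
Hypothesis injm_iota : 'injm iota.

Let iotaM h h' : iota (h * h')%g = (iota h * iota h')%g.
Proof. by rewrite morphM ?inE. Qed.
Let iotaV h : iota h^-1%g = ((iota h)^-1)%g.
Proof. by rewrite morphV ?inE. Qed.
Let iotaI : injective iota.
Proof. by move=> x y /(injmP injm_iota); apply; rewrite inE. Qed.

Definition ind_unit_fun (m : M) : {ffun G -> M} :=
  [ffun g => if [pick h | iota h == g] is Some h then kGact M h^-1%g m else 0].

Lemma ind_unit_iota m h : ind_unit_fun m (iota h) = kGact M h^-1%g m.
Proof.
rewrite ffunE; case: pickP => [h' /eqP/iotaI-> // | /(_ h)]; by rewrite eqxx.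
Qed.

Lemma ind_unit_out m g : (forall h, iota h != g) -> ind_unit_fun m g = 0.
Proof.
by move=> ng; rewrite ffunE; case: pickP => // h /eqP gh; have /eqP[] := ng h.
Qed.

Lemma ind_unit_subproof m : ind_unit_fun m \in ind_pred.
Proof.
apply/ind_predP => g h; case: (pickP (fun h1 => iota h1 == g)) => [h1 /eqP<-|ng].
  by rewrite -iotaM !ind_unit_iota invMg kGactM.
rewrite !ind_unit_out ?linear0 // => h1; first by rewrite ng.
apply/eqP => E; have /eqP[] := ng (h1 * h^-1)%g.
by rewrite iotaM iotaV E mulgK.
Qed.

Definition ind_unit (m : M) : kGind := IndCar (ind_unit_subproof m).

Lemma ind_unit_linear : linear ind_unit.
Proof.
move=> a u v; apply: ind_funP => g; rewrite !ffunE.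
by case: pickP => [h _|_]; rewrite ?linearP // scaler0 addr0.
Qed.

HB.instance Definition _ :=
  GRing.isLinear.Build k M kGind *:%R ind_unit ind_unit_linear.

Lemma ind_unit_hom h m : ind_unit (kGact M h m) = kGact kGind (iota h) (ind_unit m).
Proof.
apply: ind_funP => g; rewrite ind_actE /= -iotaV.
case: (pickP (fun h1 => iota h1 == g)) => [h1 /eqP<-|ng].
  by rewrite -iotaM !ind_unit_iota invMg invgK kGactM.
rewrite !ind_unit_out // => h1; last by rewrite ng.
apply/eqP => E; have /eqP[] := ng (h * h1)%g.
by rewrite iotaM E iotaV mulKVg.
Qed.

Let K := (iota @* [set: H])%G.
Let inK g : reflect (exists h, g = iota h) (g \in K).
Proof.
apply: (iffP morphimP) => [[h _ _ ->]|[h ->]]; first by exists h.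
by exists h; rewrite ?inE.
Qed.

Section Extension.
Variables (N : kGmod k G) (f : {linear M -> N}).
Hypothesis fP : forall h m, f (kGact M h m) = kGact N (iota h) (f m).

Let t (A : {set G}) (u : kGind) : N := kGact N (repr A) (f (u (repr A))).

Let tE A g u : A \in lcosets K [set: G] -> g \in A -> t A u = kGact N g (f (u g)).
Proof.
move=> /lcosetsP[x _ ->] gx; rewrite /t.
have : repr (lcoset K x) \in lcoset K x by apply: (mem_repr x); rewrite lcosetE lcoset_refl.
rewrite !lcosetE in gx *; move: (repr _) => r; rewrite !mem_lcoset in gx * => rx.
have /inK[h E] : (g^-1 * r)%g \in K.
  by rewrite -[r](mulKVg x) mulgA groupM // -groupV invMg invgK.
have -> : r = (g * iota h)%g by rewrite -E mulKVg.
by rewrite ind_carP fP kGactM; congr (kGact N g _); rewrite -kGactM -iotaM mulgV morph1 kGact1.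
Qed.

Definition ind_ext_fun (u : kGind) : N := \sum_(A in lcosets K [set: G]) t A u.

Lemma ind_ext_linear : linear ind_ext_fun.
Proof.
move=> a u v; rewrite /ind_ext_fun scaler_sumr -big_split /=.
by apply: eq_bigr => A _; rewrite /t !ffunE !linearP.
Qed.

HB.instance Definition _ :=
  GRing.isLinear.Build k kGind N *:%R ind_ext_fun ind_ext_linear.

Let lcos g A : ((g *: A)%g \in lcosets K [set: G]) = (A \in lcosets K [set: G]).
Proof.
apply/lcosetsP/lcosetsP => [[x _ E]|[x _ ->]]; last first.
  by exists (g * x)%g; rewrite ?inE // lcosetM.
by exists (g^-1 * x)%g; rewrite ?inE // lcosetM -E lcosetK.
Qed.

Let mem_lcos A : A \in lcosets K [set: G] -> repr A \in A.
Proof. by case/lcosetsP => x _ ->; apply: (mem_repr x); rewrite lcoset_refl. Qed.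

Lemma ind_ext_hom g u : ind_ext_fun (kGact kGind g u) = kGact N g (ind_ext_fun u).
Proof.
rewrite /ind_ext_fun linear_sum /= (reindex_inj (@lcoset_inj _ g)) /=.
apply: eq_big => A; first by rewrite lcos.
rewrite lcos => Acos; rewrite (tE (g := (g * repr A)%g)) ?lcos //; last first.
  by rewrite mem_lcoset mulKg mem_lcos.
by rewrite ind_actE mulKg kGactM.
Qed.

Definition ind_ext : kGhom kGind N := KGhom ind_ext_hom.

Lemma ind_extE m : ind_ext (ind_unit m) = f m.
Proof.
have KK : (K : {set G}) \in lcosets K [set: G].
  by apply/lcosetsP; exists 1%g; rewrite ?inE ?lcoset1.
rewrite /= /ind_ext_fun (bigD1 (K : {set G})) //= (tE (g := 1%g)) ?group1 //.
rewrite big1 ?addr0 => [|A /andP[Acos nAK]].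
  by rewrite -(morph1 iota) ind_unit_iota invg1 kGact1 morph1 kGact1.
rewrite /t ind_unit_out ?linear0 // => h; apply: contraNneq nAK => E.
have : repr A \in K by apply/inK; exists h.
have := mem_lcos Acos; case/lcosetsP: Acos => x _ ->.
rewrite mem_lcoset => xr rK; apply/eqP; apply: lcoset_id.
by rewrite -groupV -(groupMr _ rK).
Qed.

Lemma ind_decomp (u : kGind) :
  u = \sum_(A in lcosets K [set: G]) kGact kGind (repr A) (ind_unit (u (repr A))).
Proof.
apply: ind_funP => y.
have raddf_ev (F : {set G} -> kGind) (r : seq {set G}) P :
    ind_fun (\sum_(A <- r | P A) F A) y = \sum_(A <- r | P A) F A y.
  elim/big_rec2: _ => [|A a b _ <-]; by rewrite ffunE.
have Ky : (y *: K)%g \in lcosets K [set: G] by apply/lcosetsP; exists y; rewrite ?inE.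
rewrite raddf_ev (bigD1 _ Ky) /= big1 ?addr0 => [|A /andP[Acos nA]].
  have /lcosetP[z /inK[h ->] ->] := mem_lcos Ky.
  rewrite ffunE invMg -mulgA mulVg mulg1 -iotaV ind_unit_iota invgK ind_carP.
  by rewrite -kGactM mulgV kGact1.
rewrite ffunE ind_unit_out // => h; apply: contraNneq nA => E.
have := mem_lcos Acos; case/lcosetsP: Acos => x _ EA; rewrite EA mem_lcoset => xr.
rewrite eq_sym; apply/eqP/lcoset_eqP.
rewrite mem_lcoset -(mulKVg (repr A) y) -E mulgA groupM -?EA //.
  by rewrite EA.
by apply/inK; exists h.
Qed.

Lemma ind_ext_uniq (F : kGhom kGind N) : (forall m, F (ind_unit m) = f m) -> F =1 ind_ext.
Proof.
move=> FE u; rewrite [in LHS](ind_decomp u) linear_sum; apply: eq_bigr => A _.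
by rewrite kGhomP FE.
Qed.

End Extension.
End Universal.

(* The unit M -> Ind_H^G(M) is universal among H-linear maps from M to
   kG-modules. *)
Lemma ind_universal (injm_iota : 'injm iota) :
  exists eta : {linear M -> kGind},
    (forall h m, eta (kGact M h m) = kGact kGind (iota h) (eta m)) /\
    (forall (N : kGmod k G) (f : {linear M -> N}),
       (forall h m, f (kGact M h m) = kGact N (iota h) (f m)) ->
       exists F : kGhom kGind N,
         (forall m, F (eta m) = f m) /\
         (forall F' : kGhom kGind N, (forall m, F' (eta m) = f m) -> F' =1 F)).
Proof.
exists (ind_unit injm_iota : {linear M -> kGind}).
split=> [h m | N f fP]; first exact: ind_unit_hom.
exists (ind_ext fP); split; [exact: ind_extE | exact: ind_ext_uniq].
Qed.

End Induction.

(* Main.v *)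
Require Import Defs.
From Stdlib Require Import Classical IndefiniteDescription.
From HB Require Import structures.
From mathcomp Require Import all_boot all_order all_algebra all_fingroup all_solvable.
From mathcomp Require Import mxabelem.

(** Since w = Ind_H^G(k) is kC inflated to G = H x C, w-projective means
    projective relative to H.  Two facts about this notion are used, both in
    terms of [coind M] = M (x) kC.  A w-projective M is one for which the
    summation map [coind M -> M] is split ([rel_split_wprojective]).  A map of
    the form sum_x x h x^-1, with h only kH-linear, factors through [coind M]
    and so vanishes in StMod_w(kG) ([trace_stable0]).

    The theorem reduces to a question on kH-modules.  Let pi : B -> Y be a pure
    epimorphism: every map from a finite dimensional module to Y lifts to B.
    The module [phantom pi] is the pullback of [coind B -> coind Y] along the
    norm map of [coind Y].  It is an extension of [coind Y] by [coind (ker pi)],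
    and over kH this extension is pure; so finite dimensional modules cannot
    tell it from a w-projective module, and all maps from them to it are traces
    ([phantom_stable0]).  But if [phantom pi] were zero in StMod_w(kG), its
    identity map would be a trace sum_x x theta x^-1.  Evaluating this trace on
    elements built from b in B gives b = r b + s (pi b), with s kH-linear and
    pi r = |C| (...) = 0, so that s splits pi ([phantom_splits]).  Hence any
    pure epimorphism over kH that does not split refutes generation
    ([phantom_not_generated]).

    Such an epimorphism exists because H is not cyclic.  Indeed, if sigma
    generates the p-group H, then sigma - 1 is nilpotent on every kH-module, an
    indecomposable finite dimensional module is a single Jordan block for it,
    and there are at most |H| block sizes ([cyclic_finite_rep_type]).  A
    noncyclic p-group has two linearly independent homomorphisms a, b to F_p,
    by its Frattini quotient ([noncyclic_pgroup_chars]).  They make a kH-module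
    on V + V out of any operator T on V, by
      h (p, q) = (p, q + a(h) p + b(h) T p),
    that is, out of a Kronecker module.  Take V = k[X] with T the division by X
    without remainder: a Pruefer module, the union of its submodules of bounded
    degree.  The cover is V = k[X][Y] with the T that sends X^(i+1) Y^j to
    X^i Y^(j+1) and kills Y^j, a direct sum of finite Jordan blocks of all
    sizes; pi sets Y to 1.  A finite dimensional module maps into bounded
    degree, hence into a copy of one block, so pi is pure
    ([pruefer_epi_pure]).  It does not split, because T is onto on k[X], while
    the elements in the image of every power of T on k[X][Y] are zero
    ([pruefer_epi_nonsplit]). *)

Set Implicit Arguments.
Unset Strict Implicit.
Unset Printing Implicit Defensive.
Import GroupScope GRing.Theory.
Local Open Scope ring_scope.

(** * Constructions of modules and maps *)

Definition lin_of (k : fieldType) (U V : lmodType k) (f : U -> V)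
    (lf : linear f) : {linear U -> V} :=
  HB.pack f (GRing.isLinear.Build k U V *:%R f lf).

Definition mod_of (k : fieldType) (G : finGroupType) (V : lmodType k)
    (act : G -> V -> V) (act_lin : forall g, linear (act g))
    (act1 : forall v, act 1%g v = v)
    (actM : forall g h v, act (g * h)%g v = act g (act h v)) : kGmod k G :=
  @KGmod k G V (fun g => lin_of (act_lin g)) act1 actM.

Definition hom_of (k : fieldType) (G : finGroupType) (M N : kGmod k G)
    (f : M -> N) (lf : linear f)
    (fP : forall g v, f (kGact M g v) = kGact N g (f v)) : kGhom M N :=
  @KGhom k G M N (lin_of lf) fP.

Section Kernel.
Variables (k : fieldType) (G : finGroupType) (M N : kGmod k G) (f : kGhom M N).

Definition ker_pred : {pred M} := [pred v | f v == 0].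

Lemma ker_submod_closed : submod_closed ker_pred.
Proof.
split=> [|a u v]; rewrite !inE ?linear0 // => /eqP fu /eqP fv.
by rewrite linearP fu fv scaler0 addr0.
Qed.

HB.instance Definition _ :=
  GRing.isSubmodClosed.Build k M ker_pred ker_submod_closed.

Record ker_car := KerCar {ker_val : M; _ : ker_val \in ker_pred}.
HB.instance Definition _ := [isSub for ker_val].
HB.instance Definition _ := [Choice of ker_car by <:].
HB.instance Definition _ := [SubChoice_isSubLmodule of ker_car by <:].

Lemma ker_carP (v : ker_car) : f (ker_val v) = 0.
Proof. by apply/eqP; case: v. Qed.

Definition ker_mk (v : M) (fv : f v = 0) : ker_car :=
  @KerCar v (introT eqP fv : v \in ker_pred).

Lemma ker_inj (u v : ker_car) : ker_val u = ker_val v -> u = v.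
Proof. exact: val_inj. Qed.

Lemma ker_val_linear : linear ker_val.
Proof. by []. Qed.

Lemma ker_act_subproof g (v : ker_car) : f (kGact M g (ker_val v)) = 0.
Proof. by rewrite kGhomP ker_carP linear0. Qed.

Definition ker_act g (v : ker_car) : ker_car := ker_mk (ker_act_subproof g v).

Lemma ker_act_linear g : linear (ker_act g).
Proof. by move=> a u v; apply: ker_inj; rewrite /= linearP. Qed.

Lemma ker_act1 v : ker_act 1%g v = v.
Proof. by apply: ker_inj; rewrite /= kGact1. Qed.

Lemma ker_actM g h v : ker_act (g * h)%g v = ker_act g (ker_act h v).
Proof. by apply: ker_inj; rewrite /= kGactM. Qed.

Definition kGker : kGmod k G := mod_of ker_act_linear ker_act1 ker_actM.

Definition ker_incl : kGhom kGker M :=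
  @hom_of k G kGker M ker_val ker_val_linear (fun _ _ => erefl).

End Kernel.

Section DirectSum.
Variables (k : fieldType) (G : finGroupType) (M N : kGmod k G).

Lemma fst_linear : linear (fst : kGsum M N -> M). Proof. by []. Qed.

Definition sum_fst : kGhom (kGsum M N) M :=
  @hom_of k G (kGsum M N) M fst fst_linear (fun _ _ => erefl).

Lemma inl_linear : linear (fun v : M => (v, 0) : kGsum M N).
Proof. by move=> a u v; congr pair; rewrite /= scaler0 addr0. Qed.

Lemma inl_hom g (v : M) :
  (kGact M g v, 0) = kGact (kGsum M N) g ((v, 0) : kGsum M N).
Proof. by congr pair; rewrite /= linear0. Qed.

Definition sum_inl : kGhom M (kGsum M N) := hom_of inl_linear inl_hom.

End DirectSum.

(** * Relative projectivity *)

Section Coind.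
Variables (k : fieldType) (H C : finGroupType).
Notation G := (H * C)%type.
Let w : kGmod k G := kGind (pairg1_morphism H C) (kGunit k H).

(** The diagonal module M (x) kC, with u standing for sum_x u(x) (x) x; as H
    acts trivially on kC, this is w (x) M, and also M restricted to H and
    induced back to G. *)
Section CoindDef.
Variable M : kGmod k G.

Definition coind_act (g : G) (u : {ffun C -> M}) : {ffun C -> M} :=
  [ffun x => kGact M g (u (g.2^-1 * x)%g)].

Lemma coind_act_linear g : linear (coind_act g).
Proof. by move=> a u v; apply/ffunP => x; rewrite !ffunE linearP. Qed.

Lemma coind_act1 u : coind_act 1%g u = u.
Proof. by apply/ffunP => x; rewrite !ffunE kGact1 invg1 mul1g. Qed.

Lemma coind_actM g h u : coind_act (g * h)%g u = coind_act g (coind_act h u).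
Proof. by apply/ffunP => x; rewrite !ffunE kGactM /= invMg mulgA. Qed.

Definition coind : kGmod k G := mod_of coind_act_linear coind_act1 coind_actM.

Lemma coindE g (u : coind) x : kGact coind g u x = kGact M g (u (g.2^-1 * x)%g).
Proof. by rewrite /= /coind_act ffunE. Qed.

Lemma w_const (f : w) h x : f (h, x) = f (1%g, x).
Proof.
have -> : (h, x) = ((1, x) * pairg1 C h)%g :> G.
  by congr pair; rewrite /= (mul1g, mulg1).
by rewrite (ind_carP f).
Qed.

Definition w_delta_fun (x : C) : {ffun G -> kGunit k H} :=
  [ffun g : G => (g.2 == x)%:R].

Lemma w_delta_subproof x :
  w_delta_fun x \in ind_pred (M := kGunit k H) (pairg1_morphism H C).
Proof. by apply/ind_predP => g h; rewrite !ffunE /= mulg1. Qed.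

Definition w_delta x : w := IndCar (w_delta_subproof x).

Lemma w_sumE (F : C -> w) g : (\sum_x F x) g = \sum_x (F x g).
Proof. by elim/big_rec2: _ => [|x a b _ <-]; rewrite ffunE. Qed.

Lemma w_sum_delta (f : w) : f = \sum_x (f (1%g, x) : k) *: w_delta x.
Proof.
apply: ind_funP => -[h y]; rewrite w_const.
rewrite w_sumE (bigD1 y) //= big1 => [|x /negPf nxy].
  by rewrite !ffunE /= eqxx addr0 [_ *: _]mulr1.
by rewrite !ffunE /= eq_sym nxy scaler0.
Qed.

Definition coind_tensor (f : w) (m : M) : coind :=
  [ffun x => (f (1%g, x) : k) *: m].

Lemma coind_is_tensor : is_tensor coind_tensor.
Proof.
split.
- split=> [f|m] a u v; apply/ffunP => x; rewrite !ffunE.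
    by rewrite scalerDr !scalerA mulrC.
  by rewrite scalerDl scalerA.
- move=> [h c] f m; apply/ffunP => x; rewrite !ffunE /= linearZ; congr (_ *: _).
  by rewrite -[LHS]/(f (h^-1 * 1, c^-1 * x)%g) w_const.
move=> U b [bl br].
have lin : linear (fun u : coind => \sum_x b (w_delta x) (u x)).
  move=> a u v; rewrite scaler_sumr -big_split; apply: eq_bigr => x _ /=.
  by rewrite !ffunE (bl _).
exists (lin_of lin); split=> [f m /=|h' h'P u /=].
  rewrite [in RHS](w_sum_delta f).
  pose bm := lin_of (br m); rewrite -[RHS]/(bm _) linear_sum.
  apply: eq_bigr => x _; rewrite linearZ /= ffunE.
  by rewrite -[LHS]/(lin_of (bl (w_delta x)) _) linearZ.
have {1}-> : u = \sum_x coind_tensor (w_delta x) (u x).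
  apply/ffunP => y; rewrite sum_ffunE (bigD1 y) //= big1 => [|x /negPf nxy].
    by rewrite !ffunE /= eqxx scale1r addr0.
  by rewrite !ffunE /= eq_sym nxy scale0r.
by rewrite linear_sum; apply: eq_bigr => x _; rewrite h'P.
Qed.

Lemma coind_wprojective : wprojective w coind.
Proof. exact: wproj_tensor (wproj_self _) coind_is_tensor. Qed.

Definition coind_sum (u : coind) : M := \sum_x u x.

Lemma coind_sum_linear : linear coind_sum.
Proof.
move=> a u v; rewrite /coind_sum scaler_sumr -big_split /=.
by apply: eq_bigr => x _; rewrite !ffunE.
Qed.

Lemma coind_sum_hom g u : coind_sum (kGact coind g u) = kGact M g (coind_sum u).
Proof.
rewrite /coind_sum linear_sum (reindex_inj (mulgI g.2)) /=.
by apply: eq_bigr => x _; rewrite ffunE mulKg.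
Qed.

Definition coind_eps : kGhom coind M := hom_of coind_sum_linear coind_sum_hom.

End CoindDef.

Section CoindMap.
Variables (M N : kGmod k G) (f : kGhom M N).

Definition coind_map_fun (u : coind M) : coind N := [ffun x => f (u x)].

Lemma coind_map_linear : linear coind_map_fun.
Proof. by move=> a u v; apply/ffunP => x; rewrite !ffunE linearP. Qed.

Lemma coind_map_hom g u :
  coind_map_fun (kGact (coind M) g u) = kGact (coind N) g (coind_map_fun u).
Proof. by apply/ffunP => x; rewrite !ffunE /= kGhomP. Qed.

Definition coind_map : kGhom (coind M) (coind N) :=
  hom_of coind_map_linear coind_map_hom.

Lemma coind_eps_nat u : coind_eps N (coind_map u) = f (coind_eps M u).
Proof.
by rewrite /= /coind_sum linear_sum; apply: eq_bigr => x _; rewrite ffunE.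
Qed.

End CoindMap.

Definition rel_split (M : kGmod k G) : Prop :=
  exists s : kGhom M (coind M), forall v, coind_eps M (s v) = v.

(** On w = kC the splitting is the diagonal x |-> x (x) x. *)
Lemma rel_split_w : rel_split w.
Proof.
have sub (f : w) (x : C) :
    [ffun g : G => (if g.2 == x then f g else 0) : kGunit k H]
      \in ind_pred (M := kGunit k H) (pairg1_morphism H C).
  apply/ind_predP => g h; rewrite !ffunE /= mulg1; case: ifP => // _.
  exact: (ind_carP f).
pose s (f : w) : coind w := [ffun x => IndCar (sub f x)].
have s_lin : linear s.
  move=> a u v; apply/ffunP => x; apply: ind_funP => g; rewrite !ffunE /=.
  by case: ifP; rewrite ?scaler0 ?addr0.
have s_hom g u : s (kGact w g u) = kGact (coind w) g (s u).
  apply/ffunP => x; apply: ind_funP => g'; rewrite !ffunE /=.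
  by rewrite (inj_eq (mulgI _)).
exists (hom_of s_lin s_hom) => f; apply: ind_funP => g /=.
rewrite /coind_sum w_sumE (bigD1 g.2) //=.
rewrite big1 => [|x /negPf nx]; rewrite !ffunE /= ?ffunE.
  by rewrite eqxx addr0.
by rewrite eq_sym nx.
Qed.

(** Tensoring the splitting of M with N; the universal property of T gives the
    linear map, and its uniqueness clause the G-equivariance. *)
Lemma rel_split_tensor (M N T : kGmod k G) (t : M -> N -> T) :
  rel_split M -> is_tensor t -> rel_split T.
Proof.
move=> [s sP] [[tl tr] tG tU].
have bil : bilinear_map (fun u v => [ffun x => t (s u x) v] : coind T).
  split=> [u|v] a u' v'; apply/ffunP => x; rewrite !ffunE ?tl //.
  by rewrite linearP !ffunE tr.
have [S [SE _]] := tU _ _ bil.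
have ext (U : lmodType k) (f f' : {linear T -> U}) :
    (forall u v, f (t u v) = f' (t u v)) -> f =1 f'.
  move=> E; have bf : bilinear_map (fun u v => f' (t u v)).
    by split=> [u|v] a u' v'; rewrite (tl, tr) linearP.
  have [h [_ hU]] := tU _ _ bf.
  by move=> v; rewrite (hU f) // (hU f').
have S_hom g v : S (kGact T g v) = kGact (coind T) g (S v).
  apply: (ext _ (S \o kGact T g) (kGact (coind T) g \o S)) => {}u {}v /=.
  rewrite -tG !SE; apply/ffunP => x; rewrite !ffunE /= -tG kGhomP.
  by rewrite coindE.
exists (KGhom S_hom) => v.
apply: (ext _ (coind_eps T \o S) idfun) => {}u {}v /=.
rewrite SE /coind_sum -[in RHS](sP u) /= /coind_sum.
pose tv := lin_of (tr v); rewrite -[RHS]/(tv _) linear_sum.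
by apply: eq_bigr => x _; rewrite ffunE.
Qed.

(** So the w-projective modules are summands of modules M (x) kC.  A splitting is
    chosen on each term of a direct sum, and these glue by the universal
    property. *)
Lemma rel_split_wprojective (P : kGmod k G) : wprojective w P -> rel_split P.
Proof.
elim=> [|M N T t _ | I M S i_ _ IH iS | {P} M N _ [s sP] [M' [f [h [fh hf]]]]].
- exact: rel_split_w.
- exact: rel_split_tensor.
- have ext (f f' : kGhom S S) : (forall i v, f (i_ i v) = f' (i_ i v)) -> f =1 f'.
    move=> E; have [h [_ hU]] := iS _ (fun i => kGcomp f' (i_ i)).
    by move=> v; rewrite (hU f) // (hU f').
  pose s_ i := constructive_indefinite_description _ (IH i).
  have [s [sE _]] := iS _ (fun i => kGcomp (coind_map (i_ i)) (sval (s_ i))).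
  exists s => v; apply: (ext (kGcomp (coind_eps S) s) (kGid S)) => i {}v /=.
  by rewrite sE -[LHS]/(coind_eps S (coind_map _ _)) coind_eps_nat (svalP (s_ i)).
pose p1 : kGhom N M := kGcomp (sum_fst M M') f.
pose j1 : kGhom M N := kGcomp h (sum_inl M M').
exists (kGcomp (coind_map p1) (kGcomp s j1)) => v.
rewrite -[coind_eps _ _]/(coind_eps M (coind_map p1 (s (j1 v)))).
by rewrite coind_eps_nat sP /= hf.
Qed.
End Coind.

(** The trace of a kH-linear map h : M -> N is the composite of the diagonal
    M -> M (x) kC, m |-> sum_x m (x) x, with the map M (x) kC -> N that sends
    m (x) x to x h (x^-1 m). *)
Section Trace.
Variables (k : fieldType) (H C : finGroupType).
Notation G := (H * C)%type.
Let w : kGmod k G := kGind (pairg1_morphism H C) (kGunit k H).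
Variables (M N : kGmod k G) (h : {linear M -> N}).
Hypothesis hP : forall a v, h (kGact M (a, 1%g) v) = kGact N (a, 1%g) (h v).

Lemma pair_mul1 (g : G) x : (g * (1, x) = (1, g.2 * x) * (g.1, 1))%g.
Proof. by congr pair; rewrite /= ?mul1g ?mulg1. Qed.

Definition const_fun (v : M) : coind M := [ffun=> v].

Lemma const_linear : linear const_fun.
Proof. by move=> a u v; apply/ffunP => x; rewrite !ffunE. Qed.

Lemma const_hom g v : const_fun (kGact M g v) = kGact (coind M) g (const_fun v).
Proof. by apply/ffunP => x; rewrite !ffunE. Qed.

Definition trace_fun (u : coind M) : N :=
  \sum_x kGact N (1%g, x) (h (kGact M (1%g, x^-1%g) (u x))).

Lemma trace_linear : linear trace_fun.
Proof.
move=> a u v; rewrite /trace_fun scaler_sumr -big_split.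
by apply: eq_bigr => x _; rewrite !ffunE !linearP.
Qed.

Lemma trace_hom g u : trace_fun (kGact (coind M) g u) = kGact N g (trace_fun u).
Proof.
rewrite /trace_fun linear_sum (reindex_inj (mulgI g.2)) /=.
apply: eq_bigr => x _; rewrite ffunE mulKg -[RHS]kGactM pair_mul1 kGactM.
rewrite -hP -!kGactM; congr (kGact N _ (h (kGact M _ _))).
by congr pair; rewrite /= ?mul1g ?mulg1 // invMg mulgKV.
Qed.

Lemma trace_stable0 (f : kGhom M N) :
  (forall v, f v = \sum_x kGact N (1%g, x) (h (kGact M (1%g, x^-1%g) v))) ->
  stable_eq w f (kGzero M N).
Proof.
move=> fE; exists (coind M), (hom_of const_linear const_hom).
exists (hom_of trace_linear trace_hom); split=> [|v]; first exact: coind_wprojective.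
rewrite subr0 fE /= /trace_fun; apply: eq_bigr => x _; by rewrite ffunE.
Qed.

End Trace.

Lemma kG0_eq0 (k : fieldType) (G : finGroupType) (v : @kG0 k G) : v = 0.
Proof. exact: thinmx0. Qed.

(** * A module invisible to finite dimensional modules *)

Lemma opp_linear (k : fieldType) (V : lmodType k) : linear (-%R : V -> V).
Proof. by move=> a u v; rewrite opprD scalerN. Qed.

Definition opp_hom (k : fieldType) (G : finGroupType) (M : kGmod k G) : kGhom M M :=
  hom_of (@opp_linear k M) (fun g v => esym (linearN (kGact M g) v)).

Definition pure_epi (k : fieldType) (G : finGroupType) (B Y : kGmod k G)
    (pi : kGhom B Y) : Prop :=
  (forall y, exists b, pi b = y) /\
  forall N, kGfindim N -> forall f : kGhom N Y,
    exists f' : kGhom N B, forall v, pi (f' v) = f v.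

Section Phantom.
Variables (k : fieldType) (H C : finGroupType).
Notation G := (H * C)%type.
Let w : kGmod k G := kGind (pairg1_morphism H C) (kGunit k H).

Definition infl (B : kGmod k H) : kGmod k G :=
  @mod_of k G B (fun g => kGact B g.1) (fun g => linearP (kGact B g.1))
    (fun v => kGact1 v) (fun g h v => kGactM g.1 h.1 v).

Definition res (M : kGmod k G) : kGmod k H.
Proof.
refine (@mod_of k H M (fun h => kGact M (h, 1%g))
  (fun h => linearP (kGact M (h, 1%g))) _ _).
  exact: kGact1.
by move=> g h v; rewrite -kGactM; congr (kGact M _ v); congr pair; rewrite /= mulg1.
Defined.

Variables (B Y : kGmod k H) (pi : kGhom B Y).
Let E := kGsum (coind (infl B)) (coind (infl Y)).

Definition glue_fun (u : E) : coind (infl Y) :=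
  [ffun x => pi (u.1 x) - \sum_y u.2 y].

Lemma glue_linear : linear glue_fun.
Proof.
move=> a u v; apply/ffunP => x; rewrite !ffunE linearP.
have -> : \sum_y (a *: u + v).2 y = a *: \sum_y u.2 y + \sum_y v.2 y.
  by rewrite scaler_sumr -big_split; apply: eq_bigr => y _; rewrite !ffunE.
by rewrite scalerBr opprD addrACA.
Qed.

Lemma glue_hom g u : glue_fun (kGact E g u) = kGact (coind (infl Y)) g (glue_fun u).
Proof.
apply/ffunP => x; rewrite !ffunE /= linearB kGhomP; congr (_ - _).
rewrite linear_sum (reindex_inj (mulgI g.2)) /=.
by apply: eq_bigr => y _; rewrite ffunE mulKg.
Qed.

(** The pullback of [coind B -> coind Y] along the norm u |-> (x |-> sum_y u y)
    of [coind Y].  If C is cyclic of order q, a power of the characteristic, and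
    t = sigma - 1 for a generator sigma of C, then the norm is t^(q-1), and this is the q-complex A = ... = A -> B -> Y = ... = Y, for
    A = ker pi, with q-1 copies of A and of Y: the totalisation of the pure
    exact sequence A -> B -> Y. *)
Definition phantom : kGmod k G := kGker (hom_of glue_linear glue_hom).

Lemma phantomP (u : phantom) x : pi ((ker_val u).1 x) = \sum_y (ker_val u).2 y.
Proof.
apply/eqP; rewrite -subr_eq0; apply/eqP.
by have /ffunP/(_ x) := ker_carP u; rewrite !ffunE.
Qed.

(** Write f m = (be m, ga m).  The map ga is determined by its kH-linear value
    at 1, which lifts to g1 : M -> B by purity.  The image of g1 under B -> phantom,
    b |-> (constant b, pi b at 1), has a trace with second component ga.  What
    remains of be takes its values in ker pi, hence is the trace of its value at
    1.  So f is the trace of the sum h of these two kH-linear maps. *)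
Lemma phantom_stable0 (M : kGmod k G) (f : kGhom M phantom) :
  pure_epi pi -> kGfindim M -> stable_eq w f (kGzero M phantom).
Proof.
move=> [_ pure] Mfd.
pose be m : {ffun C -> B} := (ker_val (f m)).1.
pose ga m : {ffun C -> Y} := (ker_val (f m)).2.
have be_lin x : linear (fun m => be m x).
  by move=> a u v; rewrite /be linearP /= !ffunE.
have ga_lin x : linear (fun m => ga m x).
  by move=> a u v; rewrite /ga linearP /= !ffunE.
have beE g m x : be (kGact M g m) x = kGact B g.1 (be m (g.2^-1 * x)%g).
  by rewrite /be kGhomP /= ffunE.
have gaE g m x : ga (kGact M g m) x = kGact Y g.1 (ga m (g.2^-1 * x)%g).
  by rewrite /ga kGhomP /= ffunE.
have ga1_hom a (m : res M) : ga (kGact (res M) a m) 1%g = kGact Y a (ga m 1%g).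
  by rewrite gaE /= invg1 mulg1.
have [g1 g1E] := pure (res M) Mfd (@hom_of k H (res M) Y _ (ga_lin 1%g) ga1_hom).
rewrite /= in g1E.
(* The value at 1 of what the lift g1 leaves of be. *)
pose cor m : B := be m 1%g - \sum_y g1 (kGact M (1%g, y^-1%g) m).
have cor_lin : linear cor.
  move=> a u v; rewrite /cor be_lin.
  have -> : \sum_y g1 (kGact M (1%g, y^-1%g) (a *: u + v)) =
     a *: (\sum_y g1 (kGact M (1%g, y^-1%g) u)) + \sum_y g1 (kGact M (1%g, y^-1%g) v).
    by rewrite scaler_sumr -big_split; apply: eq_bigr => y _; rewrite !linearP.
  by rewrite scalerBr opprD addrACA.
have pi_cor m : pi (cor m) = 0.
  rewrite linearB linear_sum phantomP -/(ga m) -sumrB big1 // => y _ /=.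
  by rewrite g1E gaE /= kGact1 invgK mulg1 subrr.
pose hE m : E := ([ffun x => g1 m + (if x == 1%g then cor m else 0)],
                  [ffun x => if x == 1%g then ga m 1%g else 0]).
have hK m : hom_of glue_linear glue_hom (hE m) = 0.
  apply/ffunP => x; rewrite !ffunE /= (bigD1 1%g) //= big1; last first.
    by move=> y /negPf ny; rewrite ffunE ny.
  rewrite !ffunE eqxx addr0 linearD g1E addrC addrA addNr add0r.
  by case: ifP; rewrite ?linear0 ?pi_cor.
pose h m : phantom := ker_mk (hK m).
have h_lin : linear h.
  move=> a u v; apply: ker_inj; congr pair; apply/ffunP => x; rewrite !ffunE.
    rewrite linearP cor_lin; case: ifP => _; last by rewrite !addr0.
    by rewrite addrACA -scalerDr.
  by case: ifP; rewrite ?ga_lin // scaler0 addr0.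
have h_hom a v : h (kGact M (a, 1%g) v) = kGact phantom (a, 1%g) (h v).
  have g1_hom u : g1 (kGact M (a, 1%g) u) = kGact B a (g1 u) by exact: (kGhomP g1 a u).
  apply: ker_inj; congr pair; apply/ffunP => x; rewrite !ffunE invg1 mul1g /=.
    rewrite g1_hom linearD; congr (_ + _); case: ifP => _; last by rewrite linear0.
    rewrite /cor linearB beE invg1 mul1g; congr (_ - _); rewrite linear_sum.
    apply: eq_bigr => y _; rewrite -g1_hom -!kGactM; congr (g1 (kGact M _ _)).
    by congr pair; rewrite /= ?mulg1 ?mul1g.
  by case: ifP => _; rewrite ?linear0 // gaE invg1 mul1g.
apply: (@trace_stable0 k H C M phantom (lin_of h_lin) h_hom) => m.
apply: ker_inj; rewrite -[X in _ = X]/(ker_incl _ _) linear_sum /=.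
have sum1 (F : C -> E) z : (\sum_x F x).1 z = \sum_x (F x).1 z.
  by elim/big_rec2: _ => [|x u v _ <-]; rewrite !ffunE.
have sum2 (F : C -> E) z : (\sum_x F x).2 z = \sum_x (F x).2 z.
  by elim/big_rec2: _ => [|x u v _ <-]; rewrite !ffunE.
rewrite [LHS]surjective_pairing [RHS]surjective_pairing; congr pair.
  apply/ffunP => z; rewrite sum1.
  under eq_bigr => x _ do rewrite /= ffunE /= ffunE kGact1 -eq_mulVg1.
  rewrite big_split /= -big_mkcond big_pred1_eq (reindex_inj (mulgI z)) /=.
  rewrite /cor beE /= kGact1 invgK mulg1.
  under [X in X + _]eq_bigr => y _.
    have -> : kGact M (1%g, (z * y)^-1%g) m =
              kGact M (1%g, y^-1%g) (kGact M (1%g, z^-1%g) m).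
      by rewrite -kGactM; congr (kGact M _ m); congr pair; rewrite /= ?mulg1 // invMg.
    over.
  by rewrite addrC subrK.
apply/ffunP => z; rewrite sum2.
under eq_bigr => x _ do rewrite /= ffunE /= ffunE kGact1 -eq_mulVg1.
by rewrite -big_mkcond big_pred1_eq gaE /= kGact1 invgK mulg1.
Qed.

(** Let id = sum_x x theta x^-1, and let e_y b = (constant b, pi b at y), so that
    x^-1 (e_1 b) = e_(x^-1) b.  The first component at 1 of this identity on
    e_1 b says b = sum_y (theta (e_y b)).1 y.  As e_y b - e_1 b depends on pi b
    only, b is a function s of pi b, plus r b = sum_y (theta (e_1 b)).1 y.  All
    terms of r b have the same image in Y, so pi (r b) is a multiple of |C|. *)
Lemma phantom_splits (p : nat) : p \in [pchar k] -> (p %| #|C|)%N ->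
  (forall y, exists b, pi b = y) -> rel_split phantom ->
  exists s : kGhom Y B, forall y, pi (s y) = y.
Proof.
move=> kp pC pi_surj [s sP].
pose th (v : phantom) : phantom := s v 1%g.
have th_lin : linear th by move=> a u v; rewrite /th linearP !ffunE.
have thK v : v = \sum_x kGact phantom (1%g, x) (th (kGact phantom (1%g, x^-1%g) v)).
  rewrite -[LHS]sP; apply: eq_bigr => x _; rewrite /th kGhomP coindE /= invgK mulg1.
  rewrite -[RHS](@kGactM _ _ phantom).
  have -> : ((1, x) * (1, x^-1))%g = 1%g :> G by congr pair; rewrite /= ?mulg1 ?mulgV.
  by rewrite kGact1.
have th_hom a v : th (kGact phantom (a, 1%g) v) = kGact phantom (a, 1%g) (th v).
  by rewrite /th kGhomP coindE /= invg1 mul1g.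
pose eE y b : E := ([ffun=> b], [ffun x => if x == y then pi b else 0]).
pose dE (y : C) (c : Y) : E :=
  (0, [ffun x => (if x == y then c else 0) - (if x == 1%g then c else 0)]).
have sum_delta (y : C) (c : Y) : \sum_x (if x == y then c else 0) = c.
  by rewrite -big_mkcond big_pred1_eq.
have eK y b : hom_of glue_linear glue_hom (eE y b) = 0.
  apply/ffunP => x; rewrite !ffunE /=.
  by under eq_bigr do rewrite ffunE; rewrite sum_delta subrr.
have dK (y : C) (c : Y) : hom_of glue_linear glue_hom (dE y c) = 0.
  apply/ffunP => x; rewrite !ffunE /= linear0.
  by under eq_bigr do rewrite ffunE; rewrite sumrB !sum_delta !subrr.
pose e y b : phantom := ker_mk (eK y b).
pose d (y : C) (c : Y) : phantom := ker_mk (dK y c).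
have eD y b : e y b = e 1%g b + d y (pi b).
  apply: ker_inj; congr pair; apply/ffunP => x; rewrite !ffunE ?addr0 //.
  by rewrite addrC subrK.
have d_lin y : linear (d y).
  move=> a u v; apply: ker_inj; congr pair; first by rewrite /= scaler0 addr0.
  apply/ffunP => x; rewrite !ffunE scalerBr addrACA -opprD; congr (_ - _).
    by case: ifP; rewrite ?scaler0 ?addr0.
  by case: ifP; rewrite ?scaler0 ?addr0.
have d_hom y a c : d y (kGact Y a c) = kGact phantom (a, 1%g) (d y c).
  apply: ker_inj; congr pair; apply/ffunP => x; rewrite !ffunE ?linear0 //.
  by rewrite /= invg1 mul1g linearB; congr (_ - _); case: ifP; rewrite ?linear0.
pose ev y (u : phantom) : B := (ker_val u).1 y.
have ev_lin y : linear (ev y) by move=> a u v; rewrite /ev /= !ffunE.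
pose s' (c : Y) : B := \sum_y ev y (th (d y c)).
have s'_lin : linear s'.
  move=> a u v; rewrite /s' scaler_sumr -big_split; apply: eq_bigr => y _.
  by rewrite d_lin th_lin ev_lin.
have s'_hom a c : s' (kGact Y a c) = kGact B a (s' c).
  rewrite /s' linear_sum; apply: eq_bigr => y _.
  by rewrite d_hom th_hom /ev /= ffunE invg1 mul1g.
exists (hom_of s'_lin s'_hom) => c; have [b <-] := pi_surj c.
have bE : b = \sum_y ev y (th (e y b)).
  have ev_sum (F : C -> phantom) : ev 1%g (\sum_x F x) = \sum_x ev 1%g (F x).
    exact: (linear_sum (lin_of (ev_lin 1%g))).
  have {1}-> : b = ev 1%g (e 1%g b) by rewrite /ev ffunE.
  rewrite [X in ev _ X]thK ev_sum (reindex_inj invg_inj) /=.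
  apply: eq_bigr => y _; rewrite invgK /ev /= ffunE kGact1 invgK mulg1.
  congr ((ker_val (th _)).1 y); apply: ker_inj; congr pair; apply/ffunP => x.
    by rewrite !ffunE kGact1.
  by rewrite !ffunE kGact1 -eq_mulVg1 eq_sym.
rewrite {2}bE /= /s' !linear_sum /=.
have pi_ev y u : pi (ev y u) = \sum_x (ker_val u).2 x by exact: phantomP.
under [RHS]eq_bigr => y _.
  rewrite eD -[th (_ + _)]/((lin_of th_lin) _) linearD /=.
  rewrite -[ev _ _]/(lin_of (ev_lin y) _) linearD linearD [X in X + _]pi_ev.
  over.
rewrite big_split /= sumr_const -scaler_nat.
have /eqP-> : #|C|%:R == 0 :> k by rewrite -(dvdn_pcharf kp).
by rewrite scale0r add0r.
Qed.

Lemma phantom_not_generated (p : nat) : p \in [pchar k] -> (p %| #|C|)%N ->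
  pure_epi pi -> ~ (exists s : kGhom Y B, forall y, pi (s y) = y) ->
  ~ generates_StMod w (@kGfindim k G).
Proof.
move=> kp pC pure nsplit gen; apply: nsplit.
have [|f [h [[P [a [b [wP abE]]]] _]]] := gen phantom.
  by move=> M Mfd f; apply: phantom_stable0.
apply: (phantom_splits kp pC (proj1 pure)).
have [s sP] := rel_split_wprojective wP.
exists (kGcomp (coind_map b) (kGcomp s (kGcomp a (opp_hom phantom)))) => v.
rewrite -[LHS]/(coind_eps phantom (coind_map b (s (a (- v))))) coind_eps_nat sP.
by rewrite -abE /= [f _]kG0_eq0 !linear0 sub0r opprK.
Qed.
End Phantom.

(** * The Pruefer module and its cover *)

Section Bipoly.
Variable k : fieldType.

(** k[X][Y] as a vector space over k: a copy of [{poly {poly k}}], whose own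
    scalars are k[X]. *)
Definition bipoly := {poly {poly k}}.
HB.instance Definition _ := GRing.Zmodule.on bipoly.

Definition bipoly_scale (a : k) (b : bipoly) : bipoly := a%:P *: (b : {poly {poly k}}).

Lemma bipoly_scaleA a b v :
  bipoly_scale a (bipoly_scale b v) = bipoly_scale (a * b) v.
Proof. by rewrite /bipoly_scale scalerA -polyCM. Qed.
Lemma bipoly_scale1 : left_id 1 bipoly_scale.
Proof. by move=> v; rewrite /bipoly_scale scale1r. Qed.
Lemma bipoly_scaleDr : right_distributive bipoly_scale +%R.
Proof. by move=> a u v; rewrite /bipoly_scale scalerDr. Qed.
Lemma bipoly_scaleDl v : {morph bipoly_scale^~ v : a b / a + b}.
Proof. by move=> a b; rewrite /bipoly_scale polyCD scalerDl. Qed.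

HB.instance Definition _ := GRing.Zmodule_isLmodule.Build k bipoly
  bipoly_scaleA bipoly_scale1 bipoly_scaleDr bipoly_scaleDl.

Implicit Types (p : {poly k}) (b : bipoly).
Notation "b `@ i" := ((b : {poly {poly k}})`_i) (at level 2).

Lemma bicoefP b b' : (forall i, b`@i = b'`@i) -> b = b'.
Proof. by move=> E; apply/polyP. Qed.
Lemma bicoefD b b' i : (b + b')`@i = b`@i + b'`@i.
Proof. exact: coefD. Qed.
Lemma bicoefZ a b i : (a *: b)`@i = a *: b`@i.
Proof. by rewrite -mul_polyC; exact: coefZ. Qed.

(** The operator X^(i+1) |-> X^i, 1 |-> 0. *)
Definition shift p : {poly k} := drop_poly 1 p.

Lemma coef_shift p i : (shift p)`_i = p`_i.+1.
Proof. by rewrite coef_drop_poly addn1. Qed.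

Lemma shift_linear : linear shift.
Proof. by move=> a u v; apply/polyP => i; rewrite !(coef_shift, coefD, coefZ). Qed.

Lemma shift0 : shift 0 = 0.
Proof. exact: (linear0 (lin_of shift_linear)). Qed.

(** The operator X^(i+1) Y^j |-> X^i Y^(j+1), Y^j |-> 0: each space of forms of
    degree n is a nilpotent Jordan block of size n+1. *)
Definition bishift b : bipoly := 'X * map_poly shift b.

Lemma coef_bishift b i : (bishift b)`@i = if i is j.+1 then shift b`@j else 0.
Proof.
by rewrite /bishift coefXM; case: i => //= i; rewrite coef_map_id0 ?shift0.
Qed.

Lemma bishift_linear : linear bishift.
Proof.
move=> a u v; apply/bicoefP => i; rewrite !(coef_bishift, bicoefD, bicoefZ).
case: i => [|i]; rewrite ?scaler0 ?addr0 //.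
by rewrite !(coef_bishift, bicoefD, bicoefZ) shift_linear.
Qed.

Definition eval1 b : {poly k} := (b : {poly {poly k}}).[1].

Lemma eval1E n b : (size (b : {poly {poly k}}) <= n)%N ->
  eval1 b = \sum_(i < n) b`@i.
Proof.
move=> sb; rewrite /eval1 (horner_coef_wide _ sb).
by apply: eq_bigr => i _; rewrite expr1n mulr1.
Qed.

Lemma eval1_linear : linear eval1.
Proof.
move=> a u v; rewrite /eval1 hornerD; congr (_ + _).
by rewrite -[a *: u]/(a%:P *: (u : {poly {poly k}})) hornerZ mul_polyC.
Qed.

Lemma eval1_bishift b : eval1 (bishift b) = shift (eval1 b).
Proof.
rewrite (eval1E (leqnn (size b))) -[RHS]/(lin_of shift_linear _) linear_sum /=.
have sz : (size (bishift b) <= (size b).+1)%N.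
  apply/leq_sizeP => [[|j]] // bj; rewrite coef_bishift nth_default //.
  exact: shift0.
rewrite (eval1E sz) big_ord_recl coef_bishift add0r.
by apply: eq_bigr => i _; rewrite coef_bishift.
Qed.

(** Every p is some shift^n p', so that f p is in the image of bishift^n,
    which consists of multiples of Y^n; and n is arbitrary. *)
Lemma shift_divisible (f : {poly k} -> bipoly) :
  (forall p, f (shift p) = bishift (f p)) -> forall p, f p = 0.
Proof.
move=> fS p; apply/bicoefP => i; rewrite [RHS]coef0.
have {p}[p ->] : exists p', p = iter i.+1 shift p'.
  elim: i.+1 p => [|n IH] p; first by exists p.
  have [p' ->] := IH p; exists (p' * 'X); rewrite iterSr; congr (iter n _ _).
  by apply/polyP => j; rewrite coef_shift coefMX.
elim: i.+1 {-2}i (ltnSn i) => // n IH [|j] jn; rewrite /= fS coef_bishift //.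
by rewrite IH ?shift0.
Qed.

(** Homogenisation X^i |-> X^i Y^(n-i), an isomorphism from the polynomials of
    degree at most n to the forms of degree n. *)
Definition homog n p : bipoly :=
  \poly_(j < n.+1) (p`_(n - j) *: 'X^(n - j)).

Lemma coef_homog n p j :
  (homog n p)`@j = if (j <= n)%N then p`_(n - j) *: 'X^(n - j) else 0.
Proof. by rewrite coef_poly. Qed.

Lemma homog_linear n : linear (homog n).
Proof.
move=> a u v; apply/bicoefP => i; rewrite !(coef_homog, bicoefD, bicoefZ).
by case: ifP => _; rewrite ?scaler0 ?addr0 // coefD coefZ scalerDl scalerA.
Qed.

Lemma eval1_homog n p : (size p <= n.+1)%N -> eval1 (homog n p) = p.
Proof.
move=> sp; have {2}-> : p = \sum_(i < n.+1) p`_i *: 'X^i.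
  apply/polyP => i; rewrite -(poly_def _ (fun i => p`_i)) coef_poly.
  by case: ltnP => // ni; rewrite nth_default // (leq_trans sp).
rewrite (eval1E (size_poly _ _)) [RHS](reindex_inj rev_ord_inj) /=.
by apply: eq_bigr => i _; rewrite coef_homog subSS -ltnS ltn_ord.
Qed.

Lemma homog_shift n p : (size p <= n.+1)%N -> homog n (shift p) = bishift (homog n p).
Proof.
move=> sp; apply/bicoefP => -[|j]; rewrite coef_bishift !coef_homog.
  by rewrite subn0 coef_shift nth_default // scale0r.
apply/polyP => i; rewrite coef_shift; case: ltngtP => [jn|jn|->];
  rewrite ?subnn ?shift0 ?coef0 //.
  by rewrite coefZ coefXn coef_shift -(subnSK jn) coefZ coefXn eqSS.
by rewrite coef_shift coefZ coefXn mulr0.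
Qed.
End Bipoly.

(** A pair (V, T) is a Kronecker module with first arrow the identity.  It is a
    module over k[x,y]/(x,y)^2, with x (p, q) = (0, p) and y (p, q) = (0, T p),
    on which h in H acts as 1 + a(h) x + b(h) y. *)
Section Kronecker.
Variables (k : fieldType) (H : finGroupType) (a b : H -> k).
Hypotheses (aM : forall g h, a (g * h)%g = a g + a h)
           (bM : forall g h, b (g * h)%g = b g + b h).

Section Def.
Variables (V : lmodType k) (T : {linear V -> V}).

Definition kron_act (g : H) (v : V * V) : V * V :=
  (v.1, v.2 + (a g *: v.1 + b g *: T v.1)).

Lemma kron_act_linear g : linear (kron_act g).
Proof.
move=> c u v; congr pair => /=.
have DE g' : linear (fun x : V => a g' *: x + b g' *: T x).
  move=> d x y; rewrite linearP !scalerDr !scalerA ![_ * d]mulrC -!scalerA.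
  by rewrite addrACA.
by rewrite DE addrACA -scalerDr.
Qed.

Lemma hom1_eq0 (c : H -> k) : (forall g h, c (g * h)%g = c g + c h) -> c 1%g = 0.
Proof. by move=> cM; apply: (addrI (c 1%g)); rewrite -cM mulg1 addr0. Qed.

Lemma kron_act1 v : kron_act 1%g v = v.
Proof.
by case: v => p q; rewrite /kron_act !hom1_eq0 // !scale0r !addr0.
Qed.

Lemma kron_actM g h v : kron_act (g * h)%g v = kron_act g (kron_act h v).
Proof.
rewrite /kron_act /=; congr pair; rewrite aM bM !scalerDl -!addrA; congr (_ + _).
by rewrite [RHS]addrA [RHS]addrC -!addrA; congr (_ + _); rewrite addrCA.
Qed.

Definition kron : kGmod k H := mod_of kron_act_linear kron_act1 kron_actM.

End Def.

Section Map.
Variables (V W : lmodType k) (T : {linear V -> V}) (U : {linear W -> W}).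
Variables (f : {linear V -> W}).
Hypothesis fT : forall v, f (T v) = U (f v).

Definition kron_map_fun (v : kron T) : kron U := (f v.1, f v.2).

Lemma kron_map_linear : linear kron_map_fun.
Proof. by move=> c u v; congr pair; rewrite /= linearP. Qed.

Lemma kron_map_hom g v :
  kron_map_fun (kGact (kron T) g v) = kGact (kron U) g (kron_map_fun v).
Proof. by congr pair; rewrite /= !linearD !linearZ fT. Qed.

Definition kron_map : kGhom (kron T) (kron U) := hom_of kron_map_linear kron_map_hom.

End Map.

Definition pruefer := kron (lin_of (@shift_linear k)).
Definition pruefer_cover := kron (lin_of (@bishift_linear k)).
Definition pruefer_epi : kGhom pruefer_cover pruefer :=
  @kron_map _ _ (lin_of (@bishift_linear k)) (lin_of (@shift_linear k))
    (lin_of (@eval1_linear k)) (@eval1_bishift k).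

(** A map from a finite dimensional module has its values in polynomials of
    some bounded degree n, where [homog n] commutes with the operators. *)
Lemma pruefer_epi_pure : pure_epi pruefer_epi.
Proof.
split=> [[p q]|N [d [e eP]] f].
  exists (homog (size p) p, homog (size q) q).
  by congr pair; rewrite /= eval1_homog.
pose m i := maxn (size (f (e i)).1) (size (f (e i)).2).
pose n := \max_i m i.
have bnd v : (size (f v).1 <= n.+1)%N /\ (size (f v).2 <= n.+1)%N.
  have [c ->] := eP v; rewrite linear_sum.
  apply: (big_ind (fun u : pruefer => (size u.1 <= n.+1)%N /\ (size u.2 <= n.+1)%N)).
  - by rewrite size_poly0.
  - move=> u u' [u1 u2] [u'1 u'2]; split; apply: leq_trans (size_polyD _ _) _.
      by rewrite geq_max u1.
    by rewrite geq_max u2.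
  move=> i _; rewrite linearZ.
  have : (m i <= n)%N := leq_bigmax i; rewrite geq_max => /andP[i1 i2].
  split; apply: leq_trans (size_scale_leq _ _) _.
    exact: leqW.
  exact: leqW.
pose f' v : pruefer_cover := (homog n (f v).1, homog n (f v).2).
have f'_lin : linear f'.
  by move=> c u v; rewrite /f' linearP; congr pair; rewrite homog_linear.
have f'_hom g v : f' (kGact N g v) = kGact pruefer_cover g (f' v).
  rewrite /f' kGhomP; congr pair => /=; rewrite -homog_shift ?(bnd v).1 //.
  by rewrite -[homog n _]/(lin_of (@homog_linear k n) _) !linearD !linearZ.
exists (hom_of f'_lin f'_hom) => v; rewrite [RHS]surjective_pairing.
by have [v1 v2] := bnd v; congr pair; rewrite /= eval1_homog.
Qed.

(** The elements h1 - 1 and h2 - 1 of kH act as x and y.  A kH-linear s from the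
    Pruefer module has s (0, p) = x s (p, 0) = (0, f p), and comparing with y
    gives f (shift p) = bishift (f p), hence f = 0.  A section would be injective
    on the elements (0, p). *)
Lemma pruefer_epi_nonsplit (h1 h2 : H) :
  a h1 = 1 -> b h1 = 0 -> a h2 = 0 -> b h2 = 1 ->
  ~ exists s : kGhom pruefer pruefer_cover, forall y, pruefer_epi (s y) = y.
Proof.
move=> a1 b1 a2 b2 [s sP].
pose f p : bipoly k := (s (p, 0)).1.
have x_act (p : {poly k}) :
    (0, p) = kGact pruefer h1 (p, 0) - ((p, 0) : pruefer) :> pruefer.
  by congr pair; rewrite /= ?subrr // a1 b1 scale1r scale0r addr0 add0r subr0.
have s0 p : s (0, p) = (0, f p).
  rewrite x_act linearB kGhomP /= /kron_act a1 b1 scale1r scale0r addr0.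
  by congr pair; rewrite /= ?subrr // addrC addKr.
have y_act (p : {poly k}) :
    (0, shift p) = kGact pruefer h2 (p, 0) - ((p, 0) : pruefer) :> pruefer.
  by congr pair; rewrite /= ?subrr // a2 b2 scale1r scale0r !add0r subr0.
have fS p : f (shift p) = bishift (f p).
  have := s0 (shift p); rewrite y_act linearB kGhomP /= /kron_act a2 b2.
  rewrite scale1r scale0r add0r => /(congr1 snd) /= <-.
  by rewrite addrC addKr.
have := sP (0, 1); rewrite s0 (shift_divisible fS) => /(congr1 snd) /=.
rewrite [eval1 0](linear0 (lin_of (@eval1_linear k))) => /eqP.
by rewrite eq_sym oner_eq0.
Qed.
End Kronecker.

(** * Noncyclic p-groups *)

Lemma natr_Fp_add (R : nzRingType) (p : nat) (x y : 'F_p) : p \in [pchar R] ->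
  ((x + y)%R : nat)%:R = (x : nat)%:R + (y : nat)%:R :> R.
Proof.
move=> Rp; rewrite -natrD.
have mod m q : q = p -> (m %% q)%N%:R = m%:R :> R.
  by move=> ->; exact: GRing.natr_mod_pchar.
exact: (mod _ _ (Fp_cast (pcharf_prime Rp))).
Qed.

(** The Frattini quotient is a vector space over F_p whose dimension is at least
    2, since a p-group with cyclic Frattini quotient is cyclic; a and b are two
    of its coordinates. *)
Lemma noncyclic_pgroup_chars (k : fieldType) (p : nat) (H : finGroupType) :
  p \in [pchar k] -> (p.-group [set: H])%g -> ~~ cyclic [set: H]%g ->
  exists a b : H -> k, exists h1 h2 : H,
    [/\ forall g h, a (g * h)%g = a g + a h,
        forall g h, b (g * h)%g = b g + b h,
        a h1 = 1 /\ b h1 = 0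
      & a h2 = 0 /\ b h2 = 1].
Proof.
move=> kp pH ncyc; pose G := [set: H]%G; pose F := 'Phi(G)%G.
have abE : (p.-abelem (G / F))%g := Phi_quotient_abelem pH.
have ncycE : ~~ cyclic (G / F)%g by apply: contra ncyc; apply: Phi_quotient_cyclic.
have ntE : (G / F)%g != 1%g by apply: contraNneq ncycE => ->; apply: cyclic1.
have dim2 : (1 < 'dim (G / F)%g)%N.
  by rewrite (dim_abelemE abE) // ltnNge -(abelem_cyclic abE).
pose rV := abelem_rV abE ntE; pose i0 : 'I_('dim (G / F)%g) := ord0.
pose i1 := Ordinal dim2.
pose chi i (h : H) : k := (rV (coset F h) 0 i : nat)%:R.
have memE h : coset F h \in (G / F)%g by rewrite mem_quotient ?inE.
have chiM i g h : chi i (g * h)%g = chi i g + chi i h.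
  have nF x : x \in 'N(F)%g by rewrite (subsetP (gFnorm _ G)) ?inE.
  by rewrite /chi morphM // /rV abelem_rV_M ?memE // mxE; exact: natr_Fp_add.
have chi_delta i : exists h, forall j, chi j h = (j == i)%:R.
  have /morphimP[e _ eE dE] := mem_im_abelem_rV abE ntE (delta_mx 0 i).
  have /morphimP[h _ _ hE] := eE.
  exists h => j; rewrite /chi -hE /rV -dE. rewrite mxE eqxx /=; by case: (j == i).
have [[h1 h1E] [h2 h2E]] := (chi_delta i0, chi_delta i1).
by exists (chi i0), (chi i1), h1, h2; rewrite !h1E !h2E.
Qed.

(** * Cyclic p-groups have finite representation type *)

Section Functional.
Variables (k : fieldType) (M : lmodType k).

(** A spanning family with a nontrivial relation can be shortened; one without is
    a basis, and a coordinate that does not vanish on u can be rescaled. *)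
Lemma findim_functional n (e : 'I_n -> M) (u : M) :
  (forall v, exists c : 'I_n -> k, v = \sum_i c i *: e i) -> u != 0 ->
  exists phi : {linear M -> k^o}, phi u = 1.
Proof.
elim: n e => [|n IH] e eP u0.
  by have [c] := eP u; rewrite big_ord0 => uE; rewrite uE eqxx in u0.
have [[c [i ci c0]]|free] := classic (exists c : 'I_n.+1 -> k,
    exists2 i, c i != 0 & \sum_i c i *: e i = 0).
  apply: (IH (fun j => e (lift i j))) => // v; have [d ->] := eP v.
  exists (fun j => d (lift i j) - d i / c i * c (lift i j)).
  move: c0; rewrite !(bigD1_ord i) //= => /eqP; rewrite addr_eq0 => /eqP c0.
  have -> : d i *: e i = - \sum_j (d i / c i * c (lift i j)) *: e (lift i j).
    rewrite -{1}[d i](divfK ci) -scalerA c0 scalerN scaler_sumr.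
    by congr (- _); apply: eq_bigr => j _; rewrite scalerA.
  by rewrite addrC -sumrB; apply: eq_bigr => j _; rewrite scalerBl.
have coordP v : exists c : {ffun 'I_n.+1 -> k}, v == \sum_i c i *: e i.
  have [c ->] := eP v; exists [ffun i => c i].
  by apply/eqP; apply: eq_bigr => i _; rewrite ffunE.
pose coord v := xchoose (coordP v).
have coordE v : \sum_i coord v i *: e i = v by rewrite -(eqP (xchooseP (coordP v))).
have coord_uniq (c : 'I_n.+1 -> k) v i : \sum_i c i *: e i = v -> c i = coord v i.
  move=> cv; apply/eqP; rewrite -subr_eq0; apply/negPn/negP => ne; apply: free.
  exists (fun i => c i - coord v i); exists i => //.
  under eq_bigr do rewrite scalerBl.
  by rewrite sumrB cv coordE subrr.
have [i ui] : exists i, coord u i != 0.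
  apply/existsP; apply: contraNT u0 => /existsPn u0.
  rewrite -(coordE u) big1 // => i _.
  by have /negPn/eqP-> := u0 i; rewrite scale0r.
have phi_lin : linear (fun v => (coord u i)^-1 * coord v i : k^o).
  move=> a v w; rewrite -(coord_uniq (fun j => a * coord v j + coord w j) (a *: v + w)).
    by rewrite mulrDr mulrCA.
  under eq_bigr do rewrite scalerDl -scalerA.
  by rewrite big_split -scaler_sumr /= !coordE.
by exists (lin_of phi_lin); rewrite /= mulVf.
Qed.
End Functional.

Lemma kGiso0 (k : fieldType) (G : finGroupType) (M : kGmod k G) :
  kGiso M kG0 -> forall v : M, v = 0.
Proof. by move=> [f [h [fK _]]] v; rewrite -[v]fK [f v]kG0_eq0 linear0. Qed.

Section Idempotent.
Variables (k : fieldType) (G : finGroupType) (M : kGmod k G).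

Variable e : kGhom M M.
Hypothesis ee : forall v, e (e v) = e v.

Lemma idem_compl_linear : linear (fun v : M => v - e v).
Proof. by move=> a u v; rewrite linearP scalerBr opprD addrACA. Qed.

Lemma idem_compl_hom g v : kGact M g v - e (kGact M g v) = kGact M g (v - e v).
Proof. by rewrite kGhomP linearB. Qed.

Definition idem_compl : kGhom M M := hom_of idem_compl_linear idem_compl_hom.

(** An idempotent e splits M as ker (1 - e) + ker e. *)
Lemma idem_indecomposable m :
  kGindecomposable M -> m != 0 -> e m = m -> forall v, e v = v.
Proof.
move=> [_ indec] m0 em v.
have e1 u : idem_compl (e u) = 0 by rewrite /= ee subrr.
have e2 u : e (idem_compl u) = 0 by rewrite /= linearB ee subrr.
pose f u : kGsum (kGker idem_compl) (kGker e) := (ker_mk (e1 u), ker_mk (e2 u)).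
pose h (x : kGsum (kGker idem_compl) (kGker e)) : M := ker_val x.1 + ker_val x.2.
have f_lin : linear f.
  move=> a u u'; congr pair; apply: ker_inj; first exact: (linearP e).
  exact: (linearP idem_compl).
have f_hom g u : f (kGact M g u) = kGact (kGsum _ _) g (f u).
  by congr pair; apply: ker_inj; rewrite /= kGhomP // linearB.
have h_lin : linear h by move=> a u u'; rewrite /h /= scalerDr addrACA.
have h_hom g u : h (kGact (kGsum _ _) g u) = kGact M g (h u).
  by rewrite /h /= linearD.
have [||Z] := indec (kGker idem_compl) (kGker e).
- exists (hom_of f_lin f_hom), (hom_of h_lin h_hom); split=> [u|[x y]].
    by rewrite /= /h /= addrC subrK.
  have ex : e (ker_val x) = ker_val x.
    by apply/esym/eqP; rewrite -subr_eq0; apply/eqP/(ker_carP x).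
  congr pair; apply: ker_inj; rewrite /= /h /= linearD ex (ker_carP y) addr0 //.
  by rewrite addrC addKr.
- move=> /kGiso0 Z; case/eqP: m0; rewrite -em.
  exact: (congr1 (@ker_val _ _ _ _ _) (Z (ker_mk (e1 m)))).
have := congr1 (@ker_val _ _ _ _ _) (kGiso0 Z (ker_mk (e2 v))).
by move/eqP; rewrite subr_eq0 => /eqP.
Qed.
End Idempotent.

Section Unipotent.
Variables (k : fieldType) (V : lmodType k) (S : {linear V -> V}).

Lemma iter_linear (T : {linear V -> V}) n : linear (iter n T).
Proof. by elim: n => [|n IH] a u v; rewrite //= IH linearP. Qed.

Definition peval (P : {poly k}) (v : V) : V := \sum_(i < size P) P`_i *: iter i S v.

Lemma peval_wide n (P : {poly k}) v : (size P <= n)%N ->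
  peval P v = \sum_(i < n) P`_i *: iter i S v.
Proof.
move=> sP; rewrite /peval (big_ord_widen _ (fun i => P`_i *: iter i S v) sP).
rewrite big_mkcond; apply: eq_bigr => i _; case: ltnP => // ni.
by rewrite nth_default ?scale0r.
Qed.

Lemma pevalB (P Q : {poly k}) v : peval (P - Q) v = peval P v - peval Q v.
Proof.
pose n := maxn (size P) (size Q).
have sPQ : (size (P - Q)%R <= n)%N.
  by apply: leq_trans (size_polyD _ _) _; rewrite size_polyN.
rewrite !(peval_wide (n := n)) ?leq_maxl ?leq_maxr // -sumrB.
by apply: eq_bigr => i _; rewrite coefB scalerBl.
Qed.

Lemma peval_subr P u v : peval P (u - v) = peval P u - peval P v.
Proof.
rewrite /peval -sumrB; apply: eq_bigr => i _.
by rewrite -scalerBr -[iter i S (u - v)]/(lin_of (@iter_linear S i) _) linearB.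
Qed.

Lemma pevalMX P v : peval (P * 'X) v = peval P (S v).
Proof.
rewrite (peval_wide (n := (size P).+1)); last first.
  by apply: leq_trans (size_polyMleq _ _) _; rewrite size_polyX addn2.
rewrite big_ord_recl coefMX eqxx scale0r add0r; apply: eq_bigr => i _.
by rewrite coefMX /= -iterSr.
Qed.

Lemma peval1 v : peval 1 v = v.
Proof. by rewrite /peval size_poly1 big_ord1 coef1 scale1r. Qed.

Lemma pevalXn n v : peval 'X^n v = iter n S v.
Proof.
elim: n v => [|n IH] v; first by rewrite expr0 peval1.
by rewrite exprSr pevalMX IH -iterSr.
Qed.

Lemma pevalXsub1 n v : peval (('X - 1) ^+ n) v = iter n (fun v => S v - v) v.
Proof.
elim: n v => [|n IH] v; first by rewrite expr0 peval1.
by rewrite exprSr mulrBr mulr1 pevalB pevalMX -peval_subr IH -iterSr.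
Qed.

(** (X - 1)^(p^m) = X^(p^m) - 1 in characteristic p, evaluated at S. *)
Lemma iter_sub1_pchar p m v : p \in [pchar k] ->
  iter (p ^ m) (fun v => S v - v) v = iter (p ^ m) S v - v.
Proof.
move=> kp; have kXp : p \in [pchar {poly k}] by rewrite pchar_poly.
rewrite -pevalXsub1 -pevalXn -[X in _ = _ - X]peval1 -pevalB; congr (peval _ v).
elim: m => [|m IH]; first by rewrite expn0 !expr1.
rewrite expnSr !exprM IH -!(pFrobenius_autE kXp) pFrobenius_autB_comm.
  by rewrite pFrobenius_aut1.
exact: commr1.
Qed.
End Unipotent.

Section Cyclic.
Variables (k : fieldType) (H : finGroupType) (sigma : H).
Hypothesis sigma_gen : [set: H]%g = <[sigma]>%g.
Implicit Types M N : kGmod k H.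

Definition aug M (v : M) : M := kGact M sigma v - v.
Arguments aug : simpl never.

Lemma aug_linear M : linear (@aug M).
Proof. by move=> a u v; rewrite /aug linearP scalerBr opprD addrACA. Qed.

HB.instance Definition _ M :=
  GRing.isLinear.Build k M M *:%R (@aug M) (@aug_linear M).


Lemma kGactX M n v : iter n (kGact M sigma) v = kGact M (sigma ^+ n)%g v.
Proof.
elim: n => [|n IH]; first by rewrite expg0 kGact1.
by rewrite iterS IH expgS kGactM.
Qed.

Lemma aug_hom M N (f : {linear M -> N}) :
  (forall v, f (aug v) = aug (f v)) ->
  forall g v, f (kGact M g v) = kGact N g (f v).
Proof.
move=> fn g v; have /cycleP[i ->] : g \in <[sigma]>%g by rewrite -sigma_gen inE.
rewrite -!kGactX; elim: i => //= i <-.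
by have := fn (iter i (kGact M sigma) v); rewrite /aug linearB => /addIr.
Qed.

Lemma aug_nilpotent p M (v : M) : p \in [pchar k] -> (p.-group [set: H])%g ->
  iter #|H| (@aug M) v = 0.
Proof.
move=> kp pH; have [m Hm] := p_natP pH.
rewrite -cardsT Hm (iter_sub1_pchar _ _ _ kp) -Hm kGactX.
have -> : (sigma ^+ #|[set: H]|)%g = 1%g by rewrite sigma_gen -[#|_|]/#[sigma] expg_order.
by rewrite kGact1 subrr.
Qed.

Lemma iter_aug_ge M j i (v : M) :
  (forall v : M, iter j (@aug M) v = 0) -> (j <= i)%N -> iter i (@aug M) v = 0.
Proof. by move=> jP ji; rewrite -(subnKC ji) iterD jP. Qed.

(** When n is killed by aug^(j+1), and M too, a functional phi on M gives the map
    v |-> sum_(i <= j) phi(aug^(j-i) v) aug^i n.  The point is that the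
    block of size j+1 is coinduced from k, so that kH-maps from M into it
    correspond to functionals on M. *)
Section Transfer.
Variables (M N : kGmod k H) (j : nat) (phi : {linear M -> k^o}) (n : N).
Hypotheses (Mj : forall v, iter j.+1 (@aug M) v = 0)
           (nj : iter j.+1 (@aug N) n = 0).

Definition transfer_fun v : N :=
  \sum_(i < j.+1) (phi (iter (j - i) (@aug M) v) : k) *: iter i (@aug N) n.

Lemma transfer_linear : linear transfer_fun.
Proof.
move=> a u v; rewrite scaler_sumr -big_split; apply: eq_bigr => i _ /=.
by rewrite iter_linear linearP scalerDl scalerA.
Qed.

Lemma transfer_aug v : transfer_fun (aug v) = aug (transfer_fun v).
Proof.
rewrite /transfer_fun linear_sum big_ord_recl big_ord_recr /=.
rewrite subn0 -iterSr Mj linear0 scale0r add0r.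
have augZ c i : aug (c *: iter i (@aug N) n) = c *: iter i.+1 (@aug N) n.
  by rewrite linearZ.
rewrite augZ nj scaler0 addr0; apply: eq_bigr => i _ /=.
by rewrite augZ -iterSr subnSK.
Qed.

Definition transfer : kGhom M N :=
  @hom_of k H M N transfer_fun transfer_linear
    (@aug_hom M N (lin_of transfer_linear) transfer_aug).

Lemma transferE m : phi (iter j (@aug M) m) = 1 ->
  (forall i, (i < j)%N -> phi (iter i (@aug M) m) = 0) -> transfer m = n.
Proof.
move=> phij phi0; rewrite /= /transfer_fun big_ord_recl subn0 phij scale1r.
rewrite big1 ?addr0 // => i _; rewrite phi0 ?scale0r //.
by rewrite lift0 ltn_subrL /= (leq_ltn_trans _ (ltn_ord i)).
Qed.
End Transfer.

Lemma hom_aug M N (f : kGhom M N) i v : f (iter i (@aug M) v) = iter i (@aug N) (f v).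
Proof. by elim: i => //= i <-; rewrite /aug linearB kGhomP. Qed.

Lemma hom_transfer M N L (f : kGhom N L) j (phi : {linear M -> k^o}) n v :
  f (transfer_fun j phi n v) = transfer_fun j phi (f n) v.
Proof.
rewrite /transfer_fun linear_sum; apply: eq_bigr => i _.
by rewrite linearZ hom_aug.
Qed.


(** Here j is the largest exponent with aug^j nonzero on M; for a Jordan block,
    its size minus one. *)
Definition height j M : Prop :=
  (forall v, iter j.+1 (@aug M) v = 0) /\ exists m, iter j (@aug M) m != 0.

Lemma ex_height n M (v : M) : v != 0 -> (forall v, iter n (@aug M) v = 0) ->
  exists2 j, (j < n)%N & height j M.
Proof.
move=> v0; elim: n => [|n IH] nP; first by have /= vE := nP v; rewrite vE eqxx in v0.
have [[m m0]|none] := classic (exists m, iter n (@aug M) m != 0).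
  by exists n => //; split=> //; exists m.
have [|j jn jM] := IH; last by exists j => //; apply: ltnW.
by move=> u; apply/eqP/negPn/negP => u0; apply: none; exists u.
Qed.

(** The vanishing is enforced from i = j-1 downwards: subtracting
    phi(aug^r m) phi o aug^(j-r) corrects the value on aug^r m and does not
    change those on aug^i m for i > r, as aug^(j+1) = 0. *)
Lemma ex_dual_functional j M (m : M) : kGfindim M ->
  (forall v, iter j.+1 (@aug M) v = 0) -> iter j (@aug M) m != 0 ->
  exists phi : {linear M -> k^o}, phi (iter j (@aug M) m) = 1 /\
    forall i, (i < j)%N -> phi (iter i (@aug M) m) = 0.
Proof.
move=> [d [e eP]] jP m0.
suff /(_ j (leqnn j)) [phi [phi1 phi0]] : forall l, (l <= j)%N ->
    exists phi : {linear M -> k^o}, phi (iter j (@aug M) m) = 1 /\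
      forall i, (j - l <= i < j)%N -> phi (iter i (@aug M) m) = 0.
  by exists phi; split=> // i ij; apply: phi0; rewrite subnn.
elim=> [|l IH] lj.
  have [phi phi1] := findim_functional eP m0.
  by exists phi; split=> // i; rewrite subn0 leqNgt => /andP[/negPf->].
have [phi [phi1 phi0]] := IH (ltnW lj); pose r := (j - l.+1)%N.
have rj : (r < j)%N by rewrite ltn_subrL /= (leq_ltn_trans _ lj).
pose c : k := phi (iter r (@aug M) m).
have psi_lin : linear (fun v => phi v - c * phi (iter (j - r) (@aug M) v) : k^o).
  move=> a u v; rewrite iter_linear !linearP mulrDr opprD addrACA scalerBr.
  by congr (_ - _ + _); exact: mulrCA.
exists (lin_of psi_lin); split=> [|i /andP[ri ij]] /=.
  rewrite -iterD phi1 (iter_aug_ge (i := (j - r + j)%N) m jP) ?linear0 ?mulr0 ?subr0 //.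
  by rewrite -[X in (X <= _)%N]add1n leq_add2r subn_gt0.
rewrite -iterD; have [->|ri'] := eqVneq i r.
  by rewrite subnK 1?ltnW // phi1 mulr1 subrr.
have {ri ri'} ri : (r < i)%N by rewrite ltn_neqAle eq_sym ri'.
rewrite phi0 ?ij ?andbT; last first.
  by move: ri; rewrite /r subnS; case: (j - l)%N => // ?; rewrite ltnS.
rewrite (iter_aug_ge (i := (j - r + i)%N) m jP) ?linear0 ?mulr0 ?subr0 //.
have rij : (j - r + r < j - r + i)%N by rewrite ltn_add2l.
by rewrite (subnK (ltnW rj)) in rij.
Qed.

(** For phi dual to m, the transfer with n = m fixes m, so it is an idempotent
    onto the cyclic submodule generated by m; M being indecomposable, it is the
    identity. *)
Lemma uniserial_generator j M (m : M) : kGfindim M -> kGindecomposable M ->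
  (forall v, iter j.+1 (@aug M) v = 0) -> iter j (@aug M) m != 0 ->
  exists phi : {linear M -> k^o},
    (forall v, transfer_fun j phi m v = v) /\
    (forall N (n : N), iter j.+1 (@aug N) n = 0 -> transfer_fun j phi n m = n).
Proof.
move=> Mfd Mind jP m0; have [phi [phi1 phi0]] := ex_dual_functional Mfd jP m0.
exists phi; have phiE N n nj := @transferE M N j phi n jP nj m phi1 phi0.
split=> // v; pose e := transfer phi jP (jP m).
have em : e m = m by exact: phiE.
apply: (@idem_indecomposable _ _ _ e _ m Mind _ em v) => [u|].
  by rewrite [LHS]hom_transfer em.
by apply: contraNneq m0 => ->; apply/eqP/(linear0 (lin_of (iter_linear (@aug M) j))).
Qed.

(** The map taking the generator m to the generator n and the one taking n to m
    are mutually inverse. *)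
Lemma height_iso j M N : kGfindim M -> kGindecomposable M ->
  kGfindim N -> kGindecomposable N -> height j M -> height j N -> kGiso M N.
Proof.
move=> Mfd Mind Nfd Nind [Mj [m m0]] [Nj [n n0]].
have [phi [phiM phiN]] := uniserial_generator Mfd Mind Mj m0.
have [psi [psiN psiM]] := uniserial_generator Nfd Nind Nj n0.
exists (transfer phi Mj (Nj n)), (transfer psi Nj (Mj m)); split=> v.
  by rewrite [LHS]hom_transfer [transfer _ _ _ n]psiM.
by rewrite [LHS]hom_transfer [transfer _ _ _ m]phiN.
Qed.

End Cyclic.

Lemma kGiso0P (k : fieldType) (G : finGroupType) (M : kGmod k G) :
  (forall v : M, v = 0) -> kGiso M kG0.
Proof.
move=> M0; exists (kGzero M kG0), (kGzero kG0 M); split=> v /=.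
  by rewrite (M0 v).
by rewrite [v]kG0_eq0.
Qed.

(** The height of an indecomposable module is less than |H|, and it determines
    the module; one representative is picked for each height that occurs. *)
Lemma cyclic_finite_rep_type (k : fieldType) (p : nat) (H : finGroupType) :
  p \in [pchar k] -> (p.-group [set: H])%g -> cyclic [set: H]%g ->
  finite_rep_type k H.
Proof.
move=> kp pH /cyclicP[sigma sgen].
pose good (j : nat) M := [/\ kGfindim M, @kGindecomposable k H M & height sigma j M].
have [j | D DP] := @fin_all_exists 'I_#|H| (fun=> kGmod k H)
    (fun j D => forall M, good j M -> kGiso M D).
  have [[D Dj]|none] := classic (exists D, good j D).
    exists D => M [Mfd Mind Mj]; have [Dfd Dind Dj'] := Dj.
    exact: (height_iso sgen Mfd Mind Dfd Dind Mj Dj').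
  by exists kG0 => M Mj; case: none; exists M.
exists #|H|, D => M Mfd Mind.
have [v v0] : exists v : M, v != 0.
  apply: NNPP => none; case: Mind => nz _; apply: nz; apply: kGiso0P => v.
  by apply/eqP/negPn/negP => v0; apply: none; exists v.
have [j jH Mj] := ex_height v0 (fun u => aug_nilpotent sgen u kp pH).
by exists (Ordinal jH); apply: DP.
Qed.

(** * Failure of generation *)

Theorem theorem3p3 (k : fieldType) (p : nat) (hp : p \in [pchar k]%R)
    (n q : nat) (hq : q = (p ^ n)%N) (hq1 : (1 < q)%N)
    (H : finGroupType) (hH : (p.-group [set: H])%g)
    (hrep : ~ finite_rep_type k H)
    (C : finGroupType) (hC : cyclic [set: C]%g) (hCq : #|[set: C]%g| = q) :
  let G : finGroupType := (H * C)%type in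
  let w : kGmod k G := kGind (pairg1_morphism H C) (kGunit k H) in
  ~ generates_StMod w (@kGfindim k G).
Proof.
move=> G w.
have ncyc : ~~ cyclic [set: H]%g.
  by apply/negP => cyc; apply: hrep; apply: cyclic_finite_rep_type hp hH cyc.
have [a [b [h1 [h2 [aM bM [a1 b1] [a2 b2]]]]]] := noncyclic_pgroup_chars hp hH ncyc.
have pC : (p %| #|C|)%N.
  rewrite -cardsT hCq hq; case: n hq => [|m] hq'; last by rewrite expnS dvdn_mulr.
  by rewrite hq' expn0 in hq1.
apply: (phantom_not_generated hp pC (pruefer_epi_pure aM bM)).
exact: pruefer_epi_nonsplit a1 b1 a2 b2.
Qed.
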